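(* Let $\mathcal{H}$ be a complex Hilbert space and let $T\in\mathcal{B}(\mathcal{H})$ be generalized Drazin invertible with closed range. Put $P=I-TT^d$, let $$T=\begin{bmatrix} T_1 & 0\\ 0& T_2\end{bmatrix}:\begin{bmatrix}\mathcal{N}(P)\\ \mathcal{R}(P)\end{bmatrix}\to\begin{bmatrix}\mathcal{N}(P)\\ \mathcal{R}(P)\end{bmatrix}$$ be the core-quasinilpotent decomposition of $T$ (so $T_1$ is invertible and $T_2$ is quasinilpotent), and let an inner inverse of $T$ be of the form $$T^{-}=\begin{bmatrix} T_1^{-1} & Y\\ Z& T_2^{-}\end{bmatrix}:\begin{bmatrix}\mathcal{N}(P)\\ \mathcal{R}(P)\end{bmatrix}\to\begin{bmatrix}\mathcal{N}(P)\\ \mathcal{R}(P)\end{bmatrix},\quad \mathcal{R}(T_2)\subset\mathcal{N}(Y),\ \mathcal{R}(Z)\subset\mathcal{N}(T_2),$$ where $T_2^{-}$ is an inner inverse of $T_2$. Then the 1GD inverse of $T$ is given by $$T^{-GD}=\begin{bmatrix} T_1^{-1} & 0\\ Z& 0\end{bmatrix}=T^d+\begin{bmatrix} 0 & 0\\ Z& 0\end{bmatrix}:\begin{bmatrix}\mathcal{N}(P)\\ \mathcal{R}(P)\end{bmatrix}\to\begin{bmatrix}\mathcal{N}(P)\\ \mathcal{R}(P)\end{bmatrix}.$$ Consequently, $T^{-GD}=T^d$ if and only if $Z=0$.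
   Context: $\mathcal{B}(\mathcal{H})$ is the space of bounded linear operators on $\mathcal{H}$; $\mathcal{R}(\cdot)$ and $\mathcal{N}(\cdot)$ denote range and null space. An operator $Q$ is quasinilpotent if $\|Q^n\|^{1/n}\to0$. $T\in\mathcal{B}(\mathcal{H})$ is generalized Drazin invertible if there is $X\in\mathcal{B}(\mathcal{H})$ with $XTX=X$, $TX=XT$ and $T-T^2X$ quasinilpotent; such an $X$ is unique and is denoted $T^d$. An inner inverse of an operator $A$ is a bounded operator $A^{-}$ with $AA^{-}A=A$. It is known that $P=I-TT^d$ is an idempotent commuting with $T$ and that, relative to $\mathcal{H}=\mathcal{N}(P)\oplus\mathcal{R}(P)$, $T$ is block diagonal with $T_1$ invertible and $T_2$ quasinilpotent (the core-quasinilpotent decomposition). The 1GD inverse of $T$ associated with a fixed inner inverse $T^{-}$ is $T^{-GD}=T^{-}TT^d$. *)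

(* Defs.v *)
From HB Require Import structures.
From mathcomp Require Import all_boot all_order all_algebra.
From mathcomp Require Import sesquilinear complex.
From mathcomp Require Import all_classical all_reals all_analysis.

Set Implicit Arguments.
Unset Strict Implicit.
Unset Printing Implicit Defensive.

Import Order.TTheory GRing.Theory Num.Theory.
Import numFieldNormedType.Exports.
Local Open Scope classical_set_scope.
Local Open Scope ring_scope.

(* The inner product is linear in its first argument and conjugate-linear in
   the second. *)
HB.mixin Record CompleteNormedModule_isHilbert (R : realType) H
    & CompleteNormedModule R[i] H := {
  inner : {dot H for @Num.conj R[i]};
  sqr_norm_inner : forall x : H, `|x| ^+ 2 = inner x x
}.

#[short(type="hilbertType")]
HB.structure Definition Hilbert (R : realType) :=
  {H of CompleteNormedModule R[i] H & CompleteNormedModule_isHilbert R H}.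

HB.mixin Record isBoundedOp (K : numFieldType) (U V : normedModType K)
    (f : U -> V) := {
  boundedop_subproof : exists M : K, forall x, `|f x| <= M * `|x|
}.

#[short(type="boundedOp")]
HB.structure Definition BoundedOp (K : numFieldType) (U V : normedModType K) :=
  {f of @GRing.Linear K U V *:%R f & isBoundedOp K U V f}.

Notation "{ 'bounded' U -> V }" := (boundedOp U%type V%type)
  (at level 0, U at level 98, V at level 99,
   format "{ 'bounded'  U  ->  V }") : type_scope.

Lemma boundedop_ge0 (K : numFieldType) (U V : normedModType K)
    (f : {bounded U -> V}) :
  exists2 M : K, 0 <= M & forall x, `|f x| <= M * `|x|.
Proof.
have [M fM] := @boundedop_subproof _ _ _ f.
exists `|M| => // x; have M0 : 0 <= M * `|x| by exact: le_trans (fM x).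
by rewrite -[`|x|]normr_id -normrM ger0_norm.
Qed.

Section BoundedOpInstances.
Context {K : numFieldType} {U V W : normedModType K}.

Lemma bounded_id : exists M : K, forall x : U, `|idfun x| <= M * `|x|.
Proof. by exists 1 => x; rewrite mul1r. Qed.
HB.instance Definition _ := isBoundedOp.Build K U U idfun bounded_id.

Lemma bounded_null : exists M : K, forall x : U, `|(\0 : U -> V) x| <= M * `|x|.
Proof. by exists 0 => x; rewrite normr0 mul0r. Qed.
HB.instance Definition _ := isBoundedOp.Build K U V \0 bounded_null.

Lemma bounded_comp (g : {bounded V -> W}) (f : {bounded U -> V}) :
  exists M : K, forall x : U, `|(g \o f) x| <= M * `|x|.
Proof.
have [M M0 gM] := boundedop_ge0 g; have [N N0 fN] := boundedop_ge0 f.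
exists (M * N) => x; rewrite -mulrA; apply: le_trans (gM _) _.
exact: ler_wpM2l.
Qed.
HB.instance Definition _ (g : {bounded V -> W}) (f : {bounded U -> V}) :=
  isBoundedOp.Build K U W (g \o f) (bounded_comp g f).

Lemma bounded_sub (f g : {bounded U -> V}) :
  exists M : K, forall x : U, `|(f \- g) x| <= M * `|x|.
Proof.
have [M M0 fM] := boundedop_ge0 f; have [N N0 gN] := boundedop_ge0 g.
exists (M + N) => x; rewrite mulrDl; apply: le_trans (ler_normB _ _) _.
exact: lerD.
Qed.
HB.instance Definition _ (f g : {bounded U -> V}) :=
  isBoundedOp.Build K U V (f \- g) (bounded_sub f g).

End BoundedOpInstances.

Section KerRan.
Context {K : numFieldType} {U V : normedModType K} (f : {linear U -> V}).

Definition ker : {pred U} := [pred x | f x == 0].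
Definition ran : {pred V} := [pred y | y \in range f].

Lemma ker_submod : submod_closed ker.
Proof.
split=> [|a x y]; rewrite !inE ?linear0//.
by move=> /eqP fx /eqP fy; rewrite linearP fx fy scaler0 addr0.
Qed.
HB.instance Definition _ := GRing.isSubmodClosed.Build K U ker ker_submod.

Lemma ran_submod : submod_closed ran.
Proof.
split=> [|a x y]; rewrite !inE.
  by exists 0 => //; rewrite linear0.
move=> [u _ <-] [v _ <-]; exists (a *: u + v) => //; exact: linearP.
Qed.
HB.instance Definition _ := GRing.isSubmodClosed.Build K V ran ran_submod.

End KerRan.

Section LinSubspace.
Context {K : numFieldType} {V : normedModType K} (S : submodClosed V).

Record linsubspace := LinSubspace { subspace_val :> V ; _ : subspace_val \in S }.

HB.instance Definition _ := [isSub for subspace_val].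
HB.instance Definition _ := [Choice of linsubspace by <:].
HB.instance Definition _ := [SubChoice_isSubLmodule of linsubspace by <:].

Definition subspace_norm (x : linsubspace) : K := `|val x|.

Lemma subspace_normD x y :
  subspace_norm (x + y) <= subspace_norm x + subspace_norm y.
Proof. exact: ler_normD. Qed.

Lemma subspace_normZ (l : K) x :
  subspace_norm (l *: x) = `|l| * subspace_norm x.
Proof. exact: normrZ. Qed.

Lemma subspace_norm0_eq0 x : subspace_norm x = 0 -> x = 0.
Proof. by move=> /normr0_eq0 x0; apply: val_inj. Qed.

HB.instance Definition _ := Lmodule_isNormed.Build K linsubspace
  subspace_normD subspace_normZ subspace_norm0_eq0.
End LinSubspace.

Notation nullspace f := (linsubspace (ker f)).
Notation rangespace f := (linsubspace (ran f)).

Section OperatorNorm.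
Context {R : realType}.

(* Norms over R[i] take values in R[i]; complex.Re moves them back to R. *)
Definition opnorm (U V : normedModType R[i]) (f : U -> V) : R :=
  sup [set complex.Re `|f x| | x in [set x | `|x| <= 1]].

Definition quasinilpotent (U : normedModType R[i]) (Q : {bounded U -> U}) :=
  (fun n : nat => opnorm (iter n Q) `^ n%:R^-1) @ \oo --> (0 : R).
End OperatorNorm.

Section Inverses.
Context {K : numFieldType} {U : normedModType K}.
Implicit Types A B : {bounded U -> U}.

Definition two_sided_inverse A B := A \o B = idfun /\ B \o A = idfun.

Definition inner_inverse A B := A \o B \o A = A :> (U -> U).
End Inverses.

Definition gdrazin_inverse (R : realType) (H : hilbertType R)
    (T X : {bounded H -> H}) :=
  [/\ X \o T \o X = X :> (H -> H), T \o X = X \o T :> (H -> H)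
    & quasinilpotent (T \- (T \o T \o X))].

Definition oneGD (R : realType) (H : hilbertType R)
  (Tm T Td : {bounded H -> H}) : {bounded H -> H} := Tm \o T \o Td.

Section Block.
Context {K : numFieldType} {V : normedModType K} (P : {bounded V -> V}).

(* For P idempotent, x - P x lies in ker P, so the default value of insubd is
   never used and V is the direct sum of ker P and ran P. *)
Definition ker_part (x : V) : nullspace P := insubd (0 : nullspace P) (x - P x).
Definition ran_part (x : V) : rangespace P := insubd (0 : rangespace P) (P x).

Lemma val_ker_part x : P \o P = P :> (V -> V) -> \val (ker_part x) = x - P x.
Proof.
move=> PP; rewrite insubdK//; apply/eqP; rewrite /= linearB/=.
by rewrite -[P (P x)]/((P \o P) x) PP subrr.
Qed.

Lemma val_ran_part x : \val (ran_part x) = P x.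
Proof. by rewrite insubdK//; apply/mem_set; exists x. Qed.

(* The operator with matrix [A B; C D] relative to ker P (+) ran P. *)
Definition block (A : {bounded nullspace P -> nullspace P})
    (B : {bounded rangespace P -> nullspace P})
    (C : {bounded nullspace P -> rangespace P})
    (D : {bounded rangespace P -> rangespace P}) (x : V) : V :=
  (\val (A (ker_part x)) + \val (B (ran_part x))) +
  (\val (C (ker_part x)) + \val (D (ran_part x))).
End Block.

(* Main.v *)
(* Since T (Td x) is the ker P component of x, and Td x lies in ker P, where T
   acts as T1, Td has matrix [T1inv 0; 0 0].  Applying Tm to T (Td x) only sees
   the first column of the matrix of Tm, so Y and T2m disappear. *)
Require Import Defs.
From HB Require Import structures.
From mathcomp Require Import all_boot all_order all_algebra.
From mathcomp Require Import sesquilinear complex.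
From mathcomp Require Import all_classical all_reals all_analysis.

Set Implicit Arguments.
Unset Strict Implicit.
Unset Printing Implicit Defensive.

Import Order.TTheory GRing.Theory Num.Theory.
Import numFieldNormedType.Exports.
Local Open Scope classical_set_scope.
Local Open Scope ring_scope.

Section BlockOnParts.
Context {K : numFieldType} {V : normedModType K} (P : {bounded V -> V}).
Hypothesis PP : P \o P = P :> (V -> V).

(** Membership in [ker P] means [P u = 0], so subtracting [P u] changes nothing; idempotence of [P]
    lets [val_ker_part] evaluate [ker_part]. *)
Lemma ker_part_val (u : nullspace P) : ker_part P (\val u) = u.
Proof.
apply: val_inj; rewrite val_ker_part//.
by have /eqP -> := valP u; rewrite subr0.
Qed.

Lemma ran_part_val_ker (u : nullspace P) : ran_part P (\val u) = 0.
Proof.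
by apply: val_inj; rewrite val_ran_part; have /eqP -> := valP u.
Qed.

(** The [ran P] component of a vector of [ker P] is zero, so only the first column of the matrix
    acts on it. *)
Lemma block_val_ker (A : {bounded nullspace P -> nullspace P})
    (B : {bounded rangespace P -> nullspace P})
    (C : {bounded nullspace P -> rangespace P})
    (D : {bounded rangespace P -> rangespace P}) (u : nullspace P) :
  block A B C D (\val u) = \val (A u) + \val (C u).
Proof.
by rewrite /block ker_part_val ran_part_val_ker !linear0 !addr0.
Qed.

Lemma block_col (A : {bounded nullspace P -> nullspace P})
    (C : {bounded nullspace P -> rangespace P}) (x : V) :
  block A \0 C \0 x = \val (A (ker_part P x)) + \val (C (ker_part P x)).
Proof. by rewrite /block/= !addr0. Qed.

End BlockOnParts.

Section GdrazinBlock.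
Context {R : realType} {H : hilbertType R} (T Td P : {bounded H -> H}).
Hypothesis hTd : gdrazin_inverse T Td.
Hypothesis hP : P = idfun \- (T \o Td) :> (H -> H).

Lemma spectral_idempotentE x : P x = x - T (Td x).
Proof. by rewrite hP. Qed.

Lemma gdrazin_outer x : Td (T (Td x)) = Td x.
Proof. by have [e _ _] := hTd; exact: (congr1 (@^~ x) e). Qed.

Lemma gdrazin_comm x : T (Td x) = Td (T x).
Proof. by have [_ e _] := hTd; exact: (congr1 (@^~ x) e). Qed.

(** Commutation turns [T (Td (Td x))] into [Td (T (Td x))], which is [Td x]. Hence [Td] takes its
    values in [ker P]. *)
Lemma spectral_idempotent_gdrazin x : P (Td x) = 0.
Proof. by rewrite spectral_idempotentE gdrazin_comm gdrazin_outer subrr. Qed.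

(** The difference [x - P x] is [T (Td x) = Td (T x)], a value of [Td], and [P] kills it. *)
Lemma spectral_idempotent_idem : P \o P = P :> (H -> H).
Proof.
apply/funext => x /=; rewrite [in LHS](spectral_idempotentE x) linearB/=.
by rewrite gdrazin_comm spectral_idempotent_gdrazin subr0.
Qed.

Let PP := spectral_idempotent_idem.

Lemma gdrazin_idemE x : T (Td x) = \val (ker_part P x).
Proof.
by rewrite val_ker_part// spectral_idempotentE opprB addrC subrK.
Qed.

Lemma gdrazin_core (T1 T1inv : {bounded nullspace P -> nullspace P})
    (T2 : {bounded rangespace P -> rangespace P}) x :
  T = block T1 \0 \0 T2 :> (H -> H) -> T1inv \o T1 = idfun ->
  Td x = \val (T1inv (ker_part P x)).
Proof.
move=> hdec hT1.
(* [Td x] lies in [ker P], so it is its own [ker P] component and [T1] can be applied to it. *)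
have vu : \val (ker_part P (Td x)) = Td x.
  by rewrite val_ker_part// spectral_idempotent_gdrazin subr0.
have <- : T1 (ker_part P (Td x)) = ker_part P x.
  (* Only the argument of [T] is written as an element of [nullspace P]; the matrix of [T] then
     reduces to [T1] there. *)
  apply: val_inj; rewrite -gdrazin_idemE -{2}vu hdec block_val_ker//.
  by rewrite /= addr0.
by rewrite -[T1inv _]/((T1inv \o T1) _) hT1.
Qed.

End GdrazinBlock.

Theorem theorem12 (R : realType) (H : hilbertType R)
    (T Td P Tm : {bounded H -> H})
    (hTd : gdrazin_inverse T Td)
    (hT : closed (range T))
    (hP : P = idfun \- (T \o Td) :> (H -> H))
    (T1 T1inv : {bounded nullspace P -> nullspace P})
    (T2 T2m : {bounded rangespace P -> rangespace P})
    (hdec : T = block T1 \0 \0 T2 :> (H -> H))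
    (hT1 : two_sided_inverse T1 T1inv)
    (hT2 : quasinilpotent T2)
    (hTm : inner_inverse T Tm)
    (hT2m : inner_inverse T2 T2m)
    (Y : {bounded rangespace P -> nullspace P})
    (Z : {bounded nullspace P -> rangespace P})
    (hblock : Tm = block T1inv Y Z T2m :> (H -> H))
    (hY : range T2 `<=` [set y | Y y = 0])
    (hZ : range Z `<=` [set y | T2 y = 0]) :
  [/\ oneGD Tm T Td = block T1inv \0 Z \0 :> (H -> H),
      block T1inv \0 Z \0 = Td \+ block \0 \0 Z \0 :> (H -> H)
    & oneGD Tm T Td = Td :> (H -> H) <-> Z = \0 :> (nullspace P -> rangespace P)].
Proof.
have PP := spectral_idempotent_idem hTd hP.
have [_ T1K] := hT1.
have TdE x := gdrazin_core hTd hP x hdec T1K.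
have sumE : block T1inv \0 Z \0 = Td \+ block \0 \0 Z \0 :> (H -> H).
  by apply/funext => x /=; rewrite !block_col TdE/= add0r.
have GDE : oneGD Tm T Td = block T1inv \0 Z \0 :> (H -> H).
  apply/funext => x; rewrite /= (gdrazin_idemE hTd hP) hblock.
  by rewrite block_val_ker// block_col.
split=> //; rewrite GDE sumE; split=> [e|Z0].
  (* [Z] is defined on [ker P] only, so testing on vectors [\val u] suffices: cancelling
     [Td (\val u)] on both sides leaves [\val (Z u) = 0]. *)
  apply/funext => u; apply: val_inj.
  have /(congr1 (fun y => y - Td (\val u))) := congr1 (@^~ (\val u)) e.
  by rewrite /= subrr addrC addKr block_val_ker//= add0r.
by apply/funext => x; rewrite /= block_col Z0/= !addr0.
Qed.
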